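(* Let $\bm v_1,\dots,\bm v_N \in \mathbb{R}^r$ form an equiangular tight frame and let $\bm X := \mathsf{Gram}(\bm v_1,\dots,\bm v_N)$. Then $\bm X \in \mathscr{E}_4^N$ if and only if $N < \frac{r(r+1)}{2}$ or $r = 1$. If $r=1$, then $\bm X = \bm x\bm x^\top$ for some $\bm x \in\{\pm1\}^N$, and $\bm Y = (\bm x\otimes\bm x)(\bm x\otimes\bm x)^\top$ is a degree 4 pseudomoment matrix extending $\bm X$. If $r>1$ and $N < \frac{r(r+1)}{2}$, then a degree 4 pseudomoment matrix extending $\bm X$ is $$\bm Y = \mathrm{vec}(\bm X)\mathrm{vec}(\bm X)^\top + \frac{N^2(1-\frac1r)}{\frac{r(r+1)}{2} - N}\, \bm P,$$ where $\bm P$ is the orthogonal projection matrix of $\mathbb{R}^{N^2}$ onto $\mathrm{vec}(\mathsf{pert}_{\mathscr{E}_2^N}(\bm X))$; equivalently, entrywise, $$Y_{(ij)(k\ell)} = \frac{\frac{r(r-1)}{2}}{\frac{r(r+1)}{2}-N}\big(X_{ij}X_{k\ell} + X_{ik}X_{j\ell} + X_{i\ell}X_{jk}\big) - \frac{r^2(1-\frac1N)}{\frac{r(r+1)}{2}-N}\sum_{m=1}^N X_{im}X_{jm}X_{km}X_{\ell m}.$$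
   Context: Unit vectors $\bm v_1,\dots,\bm v_N\in\mathbb{R}^r$ form a unit norm tight frame (UNTF) if $\sum_i \bm v_i\bm v_i^\top = \frac{N}{r}\bm I_r$; they form an equiangular tight frame (ETF) if they form a UNTF and there is $\alpha\in[0,1]$ with $|\langle \bm v_i,\bm v_j\rangle| = \alpha$ for all $i\ne j$. $\mathsf{Gram}$ denotes the Gram matrix. $\mathscr{E}_2^N := \{\bm X \in \mathbb{R}^{N\times N}_{\mathrm{sym}} : \bm X\succeq 0,\ X_{ii}=1\ \forall i\}$. For $\bm X\in\mathscr{E}_2^N$, $\mathsf{pert}_{\mathscr{E}_2^N}(\bm X) := \{\bm A\in\mathbb{R}^{N\times N}_{\mathrm{sym}} : \bm X\pm t\bm A\in\mathscr{E}_2^N \text{ for all sufficiently small } t>0\}$. For $\bm A\in\mathbb{R}^{N\times N}$, $\mathrm{vec}(\bm A)\in\mathbb{R}^{N^2}$ has entries $\mathrm{vec}(\bm A)_{(ij)} = A_{ij}$ (lexicographic order). A degree 4 pseudomoment matrix is a matrix $\bm Y \in \mathbb{R}^{N^2\times N^2}$, rows and columns indexed by pairs $(ij)\in[N]^2$ (lexicographically ordered), such that: (1) $\bm Y\succeq 0$; (2) $Y_{(ij)(kk)}$ does not depend on $k$; (3) $Y_{(ii)(ii)} = 1$ for all $i$; (4) $Y_{(ij)(k\ell)}$ is invariant under all permutations of the four indices $i,j,k,\ell$. Such $\bm Y$ extends $\bm X\in\mathbb{R}^{N\times N}_{\mathrm{sym}}$ if $Y_{(1i)(1j)} = X_{ij}$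 for all $i,j$. $\mathscr{E}_4^N$ is the set of symmetric $\bm X \in \mathbb{R}^{N\times N}$ that are extended by some degree 4 pseudomoment matrix. *)

(* Defs.v *)
(* Real numbers are modelled by an arbitrary real closed field. *)
From HB Require Import structures.
From mathcomp Require Import all_boot all_order all_algebra all_fingroup.
Set Implicit Arguments. Unset Strict Implicit. Unset Printing Implicit Defensive.
Import Order.TTheory GRing.Theory Num.Theory.
Local Open Scope ring_scope.

Section Defs.
Variable R : rcfType.

Definition psd n (A : 'M[R]_n) : Prop :=
  A^T = A /\ forall x : 'cV[R]_n, 0 <= (x^T *m A *m x) 0 0.

(* rows of V : 'M_(N, r) are the vectors v_1, ..., v_N in R^r *)
Definition gram N r (V : 'M[R]_(N, r)) : 'M[R]_N := V *m V^T.

Definition unit_norm_rows N r (V : 'M[R]_(N, r)) : Prop :=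
  forall i, (V *m V^T) i i = 1.

(* sum_i v_i v_i^T = V^T V = (N/r) I_r *)
Definition UNTF N r (V : 'M[R]_(N, r)) : Prop :=
  unit_norm_rows V /\ V^T *m V = (N%:R / r%:R)%:M.

Definition ETF N r (V : 'M[R]_(N, r)) : Prop :=
  UNTF V /\ exists alpha : R, 0 <= alpha <= 1 /\
    forall i j : 'I_N, i != j -> `|(V *m V^T) i j| = alpha.

Definition E2 N (X : 'M[R]_N) : Prop := psd X /\ forall i, X i i = 1.

Definition pert N (X : 'M[R]_N) (A : 'M[R]_N) : Prop :=
  A^T = A /\ exists eps : R, 0 < eps /\
    forall t : R, 0 < t < eps -> E2 (X + t *: A) /\ E2 (X - t *: A).

(* vec with lexicographic ordering of pairs (ij); mxvec orders 'I_N * 'I_N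
   lexicographically. We use column vectors. *)
Definition vec N (A : 'M[R]_N) : 'cV[R]_(N * N) := (mxvec A)^T.

(* the pair (i,j) indexed by p, i.e. inverse of mxvec_index *)
Definition unvec N (p : 'I_(N * N)) : 'I_N * 'I_N :=
  enum_val (cast_ord (esym (mxvec_cast N N)) p).

Definition ent4 N (Y : 'M[R]_(N * N)) (i j k l : 'I_N) : R :=
  Y (mxvec_index i j) (mxvec_index k l).

Definition mx4 N (F : 'I_N -> 'I_N -> 'I_N -> 'I_N -> R) : 'M[R]_(N * N) :=
  \matrix_(p, q) F (unvec p).1 (unvec p).2 (unvec q).1 (unvec q).2.

Definition pseudomoment4 N (Y : 'M[R]_(N * N)) : Prop :=
  [/\ psd Y,
      (forall i j k k', ent4 Y i j k k = ent4 Y i j k' k'),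
      (forall i, ent4 Y i i i i = 1) &
      (forall i j k l a b c d : 'I_N, perm_eq [:: i; j; k; l] [:: a; b; c; d] ->
         ent4 Y i j k l = ent4 Y a b c d)].

(* Y extends X: Y_{(1i)(1j)} = X_{ij}, where 1 is the first index *)
Definition extends4 N (Y : 'M[R]_(N * N)) (X : 'M[R]_N) : Prop :=
  forall o i j : 'I_N, nat_of_ord o = 0%N -> ent4 Y o i o j = X i j.

Definition E4 N (X : 'M[R]_N) : Prop :=
  X^T = X /\ exists Y : 'M[R]_(N * N), pseudomoment4 Y /\ extends4 Y X.

Definition kronv N (x : 'cV[R]_N) : 'cV[R]_(N * N) :=
  (mxvec (\matrix_(i, j) (x i 0 * x j 0)))^T.

Definition orth_proj n (P : 'M[R]_n) (S : 'cV[R]_n -> Prop) : Prop :=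
  [/\ P^T = P, P *m P = P &
      forall v : 'cV[R]_n, (exists w, v = P *m w) <-> S v].

Definition vec_pert N (X : 'M[R]_N) (v : 'cV[R]_(N * N)) : Prop :=
  exists A, pert X A /\ v = vec A.

End Defs.

(* Main.v *)
(* Since [X *m X = (N / r) *: X], [pert X] consists of the symmetric matrices with
   zero diagonal that vanish on the kernel of [X]. Equiangularity makes the Gram
   matrix of the $v_m v_m^T$ explicitly invertible, so the orthogonal projection P
   onto [pert X] has a closed form, and its trace is $r(r+1)/2 - N$. If this is
   positive, adding the right multiple of P to [vec X *m (vec X)^T] gives a form
   symmetric in its four indices. Otherwise [pert X] is trivial; but each column
   of an extension Y of X, read as a matrix, lies in [pert X] up to a multiple of X,
   so Y is [vec X *m (vec X)^T], which is fully symmetric only if [r = 1]. *)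
Require Import Defs.
From HB Require Import structures.
From mathcomp Require Import all_boot all_order all_algebra all_fingroup.
From mathcomp Require Import ring lra.
Set Implicit Arguments.
Unset Strict Implicit.
Unset Printing Implicit Defensive.
Import Order.TTheory GRing.Theory Num.Theory.
Local Open Scope ring_scope.

(** * Pair indices, vectorization and four-index symmetry *)

Lemma unvecK N (i j : 'I_N) : unvec (mxvec_index i j) = (i, j).
Proof. by rewrite /unvec /mxvec_index cast_ordK enum_rankK. Qed.

Lemma ent4_mx4 (R : rcfType) N (F : 'I_N -> 'I_N -> 'I_N -> 'I_N -> R) i j k l :
  ent4 (mx4 F) i j k l = F i j k l.
Proof. by rewrite /ent4 mxE !unvecK. Qed.

Lemma eq_ent4 (R : rcfType) N (A B : 'M[R]_(N * N)) :
  (forall i j k l, ent4 A i j k l = ent4 B i j k l) -> A = B.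
Proof.
by move=> AB; apply/matrixP => p q; case/mxvec_indexP: p => i j;
  case/mxvec_indexP: q => k l; apply: AB.
Qed.

Lemma sum_mxvec_index (R : rcfType) N (F : 'I_(N * N) -> R) :
  \sum_p F p = \sum_i \sum_j F (mxvec_index i j).
Proof.
rewrite pair_bigA /= (reindex _ (curry_mxvec_bij N N)) /=.
by apply: eq_bigr => -[i j] _.
Qed.

Lemma vecE (R : rcfType) N (A : 'M[R]_N) i j : vec A (mxvec_index i j) 0 = A i j.
Proof. by rewrite mxE mxvecE. Qed.

Lemma ent4_outer (R : rcfType) N (A B : 'M[R]_N) i j k l :
  ent4 (vec A *m (vec B)^T) i j k l = A i j * B k l.
Proof. by rewrite /ent4 mxE big_ord1 vecE mxE vecE. Qed.

Lemma vec_inj (R : rcfType) N : injective (@vec R N).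
Proof. by move=> A B AB; apply/matrixP => i j; rewrite -!vecE AB. Qed.

Lemma vecK (R : rcfType) N (w : 'cV[R]_(N * N)) : vec (vec_mx w^T) = w.
Proof. by rewrite /vec vec_mxK trmxK. Qed.

Lemma eq_vec_entries (R : rcfType) N (v : 'cV[R]_(N * N)) (A : 'M[R]_N) :
  (forall i j, v (mxvec_index i j) 0 = A i j) -> v = vec A.
Proof.
move=> vA; apply/matrixP => p q; rewrite ord1.
by case/mxvec_indexP: p => i j; rewrite vA vecE.
Qed.

Lemma mulmx_vecE (R : rcfType) N (Y : 'M[R]_(N * N)) (A : 'M[R]_N) i j :
  (Y *m vec A) (mxvec_index i j) 0 = \sum_k \sum_l ent4 Y i j k l * A k l.
Proof.
rewrite mxE sum_mxvec_index; apply: eq_bigr => k _; apply: eq_bigr => l _.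
by rewrite vecE.
Qed.

Lemma eq_mulmx_cV (R : rcfType) m n (A B : 'M[R]_(m, n)) :
  (forall w : 'cV[R]_n, A *m w = B *m w) -> A = B.
Proof. by move=> AB; apply/trmx_inj/row_matrixP => i; rewrite -!tr_col !colE AB. Qed.

(** Adjacent transpositions generate the symmetric group. [h2] and [h3] treat the last two and three
    arguments; each stage finds where the leading argument goes and swaps it to the front. *)
Lemma perm_eq_invariant4 (T : eqType) (U : Type) (F : T -> T -> T -> T -> U) :
  (forall i j k l, F i j k l = F j i k l) ->
  (forall i j k l, F i j k l = F i k j l) ->
  (forall i j k l, F i j k l = F i j l k) ->
  forall i j k l a b c d : T, perm_eq [:: i; j; k; l] [:: a; b; c; d] ->
    F i j k l = F a b c d.
Proof.
move=> s12 s23 s34.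
have h2 x y : forall k l c d, perm_eq [:: k; l] [:: c; d] -> F x y k l = F x y c d.
  move=> k l c d pkl; have: k \in [:: c; d] by rewrite -(perm_mem pkl) inE eqxx.
  have one u v : perm_eq [:: u] [:: v] -> u = v.
    by move/perm_mem/(_ u); rewrite !inE eqxx => /esym/eqP.
  rewrite !inE => /orP[]/eqP E; subst k.
    by move: pkl; rewrite perm_cons => /one ->.
  move: pkl; rewrite (perm_sym _ [:: c; d]) (perm_catC [:: c] [:: d]) perm_sym /=.
  by rewrite perm_cons => /one ->.
have h3 x : forall j k l b c d,
    perm_eq [:: j; k; l] [:: b; c; d] -> F x j k l = F x b c d.
  move=> j k l b c d p; have: j \in [:: b; c; d] by rewrite -(perm_mem p) inE eqxx.
  rewrite !inE => /or3P[]/eqP E; subst j.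
  - by move: p; rewrite perm_cons => /h2.
  - move: p; rewrite (perm_sym _ [:: b; c; d]) (perm_catCA [:: b] [:: c] [:: d]) perm_sym /=.
    by rewrite perm_cons s23 (s23 x b) => /h2 h; rewrite -s23 h.
  - move: p; rewrite (perm_sym _ [:: b; c; d]) (perm_catC [:: b; c] [:: d]) perm_sym /=.
    by rewrite perm_cons => /h2 ->; rewrite s23 s34.
move=> i j k l a b c d p.
have: i \in [:: a; b; c; d] by rewrite -(perm_mem p) inE eqxx.
rewrite !inE => /or4P[]/eqP E; subst i.
- by move: p; rewrite perm_cons => /h3.
- move: p; rewrite (perm_sym _ [:: a; b; c; d]) (perm_catCA [:: a] [:: b] [:: c; d]) perm_sym /=.
  by rewrite perm_cons => /h3 ->; rewrite s12.
- move: p; rewrite (perm_sym _ [:: a; b; c; d]) (perm_catCA [:: a; b] [:: c] [:: d]) perm_sym /=.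
  by rewrite perm_cons => /h3 ->; rewrite s12 s23.
- move: p; rewrite (perm_sym _ [:: a; b; c; d]) (perm_catC [:: a; b; c] [:: d]) perm_sym /=.
  by rewrite perm_cons => /h3 ->; rewrite s12 s23 s34.
Qed.

(** * Quadratic forms and orthogonal projections *)

Lemma sqr_cVE (R : rcfType) n (x : 'cV[R]_n) : (x^T *m x) 0 0 = \sum_i x i 0 ^+ 2.
Proof. by rewrite mxE; apply: eq_bigr => i _; rewrite mxE expr2. Qed.

Lemma sqr_cV_ge0 (R : rcfType) n (x : 'cV[R]_n) : 0 <= (x^T *m x) 0 0.
Proof. by rewrite sqr_cVE sumr_ge0 // => i _; rewrite sqr_ge0. Qed.

Lemma sqr_cV_eq0 (R : rcfType) n (x : 'cV[R]_n) : (x^T *m x) 0 0 = 0 -> x = 0.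
Proof.
rewrite sqr_cVE => /eqP; rewrite psumr_eq0; last by move=> i _; rewrite sqr_ge0.
move=> /allP x0; apply/matrixP => i j; rewrite ord1 [RHS]mxE.
by have /= := x0 i (mem_index_enum i); rewrite sqrf_eq0 => /eqP.
Qed.

Lemma addmxE (R : rcfType) m n (A B : 'M[R]_(m, n)) i j :
  (A + B) i j = A i j + B i j.
Proof. by rewrite mxE. Qed.

Lemma scalemxE (R : rcfType) m n (A : 'M[R]_(m, n)) (a : R) i j :
  (a *: A) i j = a * A i j.
Proof. by rewrite mxE. Qed.

Lemma quadratic_ge0_slope0 (R : rcfType) (b c : R) :
  0 <= c -> (forall t, 0 <= t * b *+ 2 + t ^+ 2 * c) -> b = 0.
Proof.
(* The minimizer [- b / c] is shifted to [- b / (c + 1)], which also serves when [c = 0]. *)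
move=> c0 /(_ (- b / (c + 1))).
have c1 : 0 < c + 1 by lra.
have -> : - b / (c + 1) * b *+ 2 + (- b / (c + 1)) ^+ 2 * c
   = - (b ^+ 2 * (c + 2)) / (c + 1) ^+ 2 by field; lra.
rewrite pmulr_lge0 ?invr_gt0 ?exprn_gt0 // => h.
by apply/eqP; rewrite -sqrf_eq0 eq_le sqr_ge0 andbT; have := sqr_ge0 b; nra.
Qed.

(* If $x^T M x = 0$ then $t \mapsto (x + t M x)^T M (x + t M x)$ is a nonnegative
   quadratic polynomial without constant term, so its slope $2 |M x|^2$ vanishes. *)
Lemma psd_quad0 (R : rcfType) n (M : 'M[R]_n) (x : 'cV[R]_n) :
  psd M -> (x^T *m M *m x) 0 0 = 0 -> M *m x = 0.
Proof.
move=> [Msym Mge0] xMx; apply: sqr_cV_eq0.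
set b := (_ 0 0); set y := M *m x.
have yT : y^T = x^T *m M by rewrite /y trmx_mul Msym.
set c := (y^T *m M *m y) 0 0.
have c0 : 0 <= c by exact: Mge0.
have quad t : 0 <= t * b *+ 2 + t ^+ 2 * c.
  have := Mge0 (x + t *: y).
  have -> : (x + t *: y)^T *m M *m (x + t *: y) = x^T *m M *m x +
      (t *: (y^T *m y) + t *: (y^T *m y)) + t ^+ 2 *: (y^T *m M *m y).
    rewrite [(x + _)^T]linearD /= [(t *: y)^T]linearZ /= !mulmxDl !mulmxDr.
    rewrite -!scalemxAl -!scalemxAr scalerA -expr2.
    have -> : x^T *m M *m y = y^T *m y by rewrite yT.
    have -> : y^T *m M *m x = y^T *m y by rewrite -mulmxA.
    by rewrite !addrA.
  by rewrite !(addmxE, scalemxE) xMx add0r mulr2n.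
exact: quadratic_ge0_slope0 c0 quad.
Qed.

Lemma mulmx3E (R : rcfType) m n p q (A : 'M[R]_(m, n)) (B : 'M[R]_(n, p))
    (C : 'M[R]_(p, q)) i j :
  (A *m B *m C) i j = \sum_k \sum_l A i k * B k l * C l j.
Proof.
rewrite mxE exchange_big /=; apply: eq_bigr => l _.
by rewrite mxE mulr_suml.
Qed.

(** Each product $|y_i y_j|$ is at most $(y_i^2 + y_j^2)/2$, hence at most $|y|^2$. *)
Lemma norm_quad_le (R : rcfType) n (A : 'M[R]_n) (y : 'cV[R]_n) :
  `|(y^T *m A *m y) 0 0| <= (\sum_i \sum_j `|A i j|) * (y^T *m y) 0 0.
Proof.
have yi i : y i 0 ^+ 2 <= (y^T *m y) 0 0.
  rewrite sqr_cVE (bigD1 i) //= lerDl sumr_ge0 // => j _; exact: sqr_ge0.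
rewrite mulmx3E mulr_suml; apply: le_trans (ler_norm_sum _ _ _) _.
apply: ler_sum => i _; rewrite mulr_suml; apply: le_trans (ler_norm_sum _ _ _) _.
apply: ler_sum => j _; rewrite mxE mulrAC !normrM mulrC.
apply: ler_wpM2l => //.
have := yi i; have := yi j; rewrite -[y i 0 ^+ 2]real_normK ?num_real //.
rewrite -[y j 0 ^+ 2]real_normK ?num_real // => h1 h2.
have := sqr_ge0 (`|y i 0| - `|y j 0|); nra.
Qed.

(** Since $P = P P^T$, the trace is the sum of the squares of all entries. *)
Lemma sym_idem_tr_le0 (R : rcfType) n (P : 'M[R]_n) :
  P^T = P -> P *m P = P -> \tr P <= 0 -> P = 0.
Proof.
move=> PT PP trP.
have trE : \tr P = \sum_i \sum_j P i j ^+ 2.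
  rewrite -{1}PP; apply: eq_bigr => i _; rewrite mxE; apply: eq_bigr => j _.
  by rewrite -{2}PT mxE expr2.
have sq0 i : 0 <= \sum_j P i j ^+ 2 by apply: sumr_ge0 => j _; exact: sqr_ge0.
have /eqP : \tr P = 0 by apply/le_anti; rewrite trP trE sumr_ge0.
rewrite trE psumr_eq0 // => /allP Pi; apply/matrixP => i j; rewrite [RHS]mxE.
have := Pi i (mem_index_enum i); rewrite /= psumr_eq0 => [/allP Pij|k _]; last exact: sqr_ge0.
by have := Pij j (mem_index_enum j); rewrite /= sqrf_eq0 => /eqP.
Qed.

(** Each projection fixes the range of the other, so $PQ = Q$ and $QP = P$; transposing the second
    identity gives $P = PQ = Q$. *)
Lemma orth_proj_unique (R : rcfType) n (S : 'cV[R]_n -> Prop) (P Q : 'M[R]_n) :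
  orth_proj P S -> orth_proj Q S -> P = Q.
Proof.
move=> [PT PP PS] [QT QQ QS].
have fixes (P1 P2 : 'M[R]_n) : P1 *m P1 = P1 ->
    (forall v, (exists w, v = P1 *m w) <-> S v) ->
    (forall v, (exists w, v = P2 *m w) <-> S v) -> P1 *m P2 = P2.
  move=> PP1 S1 S2; apply: eq_mulmx_cV => w.
  have /S2/S1[w' E] : exists w', P2 *m w = P2 *m w' by exists w.
  by rewrite -mulmxA E mulmxA PP1.
by rewrite -PT -(fixes Q P) // trmx_mul PT QT (fixes P Q).
Qed.

(** * Perturbations of a Gram matrix proportional to a projection *)

(* This is [pert X] when [X] is a Gram matrix with [X *m X = c *: X]. *)
Definition flat_pert (R : rcfType) N (X : 'M[R]_N) (c : R) (A : 'M[R]_N) : Prop :=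
  [/\ A^T = A, A *m X = c *: A & forall i, A i i = 0].

(** Every vector $Xw - cw$ lies in the kernel of [X], hence in that of [A]. *)
Lemma mulmx_annihilator (R : rcfType) m n (X : 'M[R]_n) (c : R) (A : 'M[R]_(m, n)) :
  X *m X = c *: X -> (forall u : 'cV[R]_n, X *m u = 0 -> A *m u = 0) ->
  A *m X = c *: A.
Proof.
move=> XX kerA; apply: eq_mulmx_cV => w; apply/eqP; rewrite -subr_eq0; apply/eqP.
have := kerA (X *m w - c *: w).
rewrite !mulmxBr !mulmxA XX -!scalemxAr -!scalemxAl subrr; exact.
Qed.

(** For [u] in the kernel of [X], the forms of $X \pm tA$ at [u] are $\pm t\, u^T A u$. Both are
    nonnegative, so both vanish, and semidefiniteness gives $(X + tA) u = 0$. *)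
Lemma pert_flat (R : rcfType) N (X : 'M[R]_N) (c : R) (A : 'M[R]_N) :
  X *m X = c *: X -> (forall i, X i i = 1) -> pert X A -> flat_pert X c A.
Proof.
move=> XX X1 [AT [e [e0 pA]]]; set t := e / 2.
have t0 : 0 < t by rewrite divr_gt0.
have /pA[[psdp dp] [psdm dm]] : 0 < t < e by rewrite t0 /t; lra.
split=> //; last first.
  move=> i; have := dp i; rewrite addmxE scalemxE X1 => /eqP.
  by rewrite -subr_eq0 addrAC subrr add0r mulf_eq0 gt_eqF //= => /eqP.
apply: mulmx_annihilator => // u Xu.
have Mu s : (u^T *m (X + s *: A) *m u) 0 0 = s * (u^T *m A *m u) 0 0.
  by rewrite -mulmxA mulmxDl Xu add0r -scalemxAl -scalemxAr scalemxE mulmxA.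
have := psdm.2 u; rewrite -scaleNr Mu mulNr oppr_ge0 => tle.
have := psdp.2 u; rewrite Mu => tge.
have /(psd_quad0 psdp) : (u^T *m (X + t *: A) *m u) 0 0 = 0.
  by rewrite Mu; apply/le_anti; rewrite tle.
rewrite mulmxDl Xu add0r -scalemxAl => /eqP; rewrite scaler_eq0 gt_eqF //=.
by move/eqP.
Qed.

(** With $y = Xu$, the form of $X + tA$ at [u] becomes $c^{-1}|y|^2 + t c^{-2} y^T A y$, whose
    second term is dominated by the first for small [t]. *)
Lemma flat_pert_E2 (R : rcfType) N (X : 'M[R]_N) (c : R) (A : 'M[R]_N) (t : R) :
  0 < c -> X^T = X -> X *m X = c *: X -> (forall i, X i i = 1) ->
  flat_pert X c A -> `|t| * (\sum_i \sum_j `|A i j|) <= c -> E2 (X + t *: A).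
Proof.
move=> c0 XT XX X1 [AT AX A0] tC.
have XA : X *m A = c *: A by apply: trmx_inj; rewrite trmx_mul AT XT AX linearZ /= AT.
split; last by move=> i; rewrite addmxE scalemxE X1 A0 mulr0 addr0.
split; first by rewrite linearD linearZ /= XT AT.
move=> u; set y := X *m u.
have yT : y^T = u^T *m X by rewrite trmx_mul XT.
have -> : u^T *m (X + t *: A) *m u =
    c^-1 *: (y^T *m y) + (t * c^-2) *: (y^T *m A *m y).
  have cn0 : c != 0 by rewrite gt_eqF.
  rewrite mulmxDr mulmxDl yT /y !mulmxA -(mulmxA _ X X) XX.
  rewrite -(mulmxA _ X A) XA -!scalemxAr -!scalemxAl -(mulmxA _ A X) AX.
  rewrite -!scalemxAr -!scalemxAl !scalerA mulVf // scale1r.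
  by congr (_ + _ *: _); field.
rewrite addmxE !scalemxE.
have := norm_quad_le A y; have := sqr_cV_ge0 y.
move: ((y^T *m y) 0 0) ((y^T *m A *m y) 0 0) => s q s0 qle.
have : `|t * q| <= c * s.
  rewrite normrM; apply: le_trans (ler_wpM2l _ qle) _ => //.
  by rewrite mulrA ler_wpM2r.
rewrite ler_norml => /andP[h _].
have -> : c^-1 * s + t / c ^+ 2 * q = (c * s + t * q) / c ^+ 2 by field; rewrite gt_eqF.
by apply: divr_ge0; [lra | exact: sqr_ge0].
Qed.

Lemma flat_pert_pert (R : rcfType) N (X : 'M[R]_N) (c : R) (A : 'M[R]_N) :
  0 < c -> X^T = X -> X *m X = c *: X -> (forall i, X i i = 1) ->
  flat_pert X c A -> pert X A.
Proof.
move=> c0 XT XX X1 fA; have [AT _ _] := fA; split=> //.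
set C := \sum_i \sum_j `|A i j|.
have C0 : 0 <= C by apply: sumr_ge0 => i _; apply: sumr_ge0.
have C1 : 0 < C + 1 by lra.
(* The added 1 keeps the bound defined when [A = 0]. *)
exists (c / (C + 1)); split; first exact: divr_gt0.
move=> t /andP[t0]; rewrite ltr_pdivlMr // => tC.
by split; [|rewrite -scaleNr]; apply: (flat_pert_E2 c0) => //;
  rewrite ?normrN gtr0_norm // -/C; nra.
Qed.

(** * The projection onto the perturbations of an equiangular tight frame *)

(* Gram matrices of equiangular tight frames of [N] vectors, with [c = N / r]
   and [a] the squared cosine of the common angle. *)
Definition etf_gram (R : rcfType) N (X : 'M[R]_N) (c a : R) : Prop :=
  [/\ X^T = X, X *m X = c *: X, forall i, X i i = 1 &
      forall i j, i != j -> X i j ^+ 2 = a].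

(* The vectors $v_m v_m^T$ have Gram matrix $(1 - a) I + a J$; inverting it gives
   the projection onto the orthogonal complement of their span among the
   symmetric matrices, written here in the coordinates of [X]. *)
Definition pert_ker4 (R : rcfType) N (X : 'M[R]_N) (c a : R) (i j k l : 'I_N) : R :=
  c ^- 2 * ((X i k * X j l + X i l * X j k) / 2 -
    (1 - a)^-1 * (\sum_m X i m * X j m * X k m * X l m - a * c * (X i j * X k l))).

(** The operator with kernel [pert_ker4], acting on matrices. As $1 + (N-1)a = c$, the inverse of
    $(1-a)I + aJ$ is $(1-a)^{-1}(I - (a/c)J)$; the diagonal term comes from $I$ and the trace term
    from $J$. *)
Definition pert_map (R : rcfType) N (X : 'M[R]_N) (c a : R) (A : 'M[R]_N) : 'M[R]_N :=
  c ^- 2 *: (X *m (2^-1 *: (A + A^T) -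
      (1 - a)^-1 *: diag_mx (\row_m (X *m A *m X) m m)) *m X
    + ((1 - a)^-1 * (a * c) * \tr (X *m A)) *: X).

Section ETFGram.
Variables (R : rcfType) (N : nat) (X : 'M[R]_N) (c a : R).
Hypothesis etfX : etf_gram X c a.

Let XT : X^T = X. Proof. by case: etfX. Qed.
Let XX : X *m X = c *: X. Proof. by case: etfX. Qed.
Let X1 i : X i i = 1. Proof. by case: etfX. Qed.
Let Xa i j : i != j -> X i j ^+ 2 = a. Proof. by case: etfX => _ _ _; apply. Qed.

Let Xsym i j : X i j = X j i. Proof. by rewrite -{1}XT mxE. Qed.

Lemma etf_gram_row_norm i : \sum_j X i j ^+ 2 = c.
Proof.
have : (X *m X) i i = c by rewrite XX scalemxE X1 mulr1.
by move=> <-; rewrite mxE; apply: eq_bigr => j _; rewrite [X j i]Xsym expr2.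
Qed.

Lemma etf_gram_constants : (0 < N)%N -> c = 1 + (N%:R - 1) * a.
Proof.
move=> N0; rewrite -(etf_gram_row_norm (Ordinal N0)) (bigD1 (Ordinal N0)) //=.
rewrite X1 expr1n (eq_bigr (fun=> a)) => [|j ne]; last by rewrite Xa // eq_sym.
congr (_ + _); rewrite sumr_const cardC1 card_ord -[a *+ _]mulr_natl.
by rewrite -[N in RHS](prednK N0) -natr1 addrK.
Qed.

Lemma mulmx_pert_ker4 (A : 'M[R]_N) :
  mx4 (pert_ker4 X c a) *m vec A = vec (pert_map X c a A).
Proof.
apply: eq_vec_entries => i j; rewrite mulmx_vecE.
rewrite !(addmxE, scalemxE) mulmxBr mulmxBl -!scalemxAr -!scalemxAl.
rewrite mulmxDr mulmxDl mul_mx_diag [X in c ^- 2 * (X + _)]mxE.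
rewrite [X in c ^- 2 * (_ + X + _)]mxE !scalemxE addmxE.
have E1 : (X *m A *m X) i j = \sum_k \sum_l X i k * X j l * A k l.
  rewrite mulmx3E; apply: eq_bigr => k _; apply: eq_bigr => l _.
  by rewrite (Xsym j l) mulrAC.
have E2 : (X *m A^T *m X) i j = \sum_k \sum_l X i l * X j k * A k l.
  rewrite mulmx3E exchange_big; apply: eq_bigr => k _; apply: eq_bigr => l _.
  by rewrite mxE (Xsym j k) mulrAC.
have E3 : \tr (X *m A) = \sum_k \sum_l X k l * A k l.
  rewrite /mxtrace exchange_big; apply: eq_bigr => k _.
  by rewrite mxE; apply: eq_bigr => l _; rewrite Xsym.
have E4 : ((\matrix_(p, q) (X p q * (\row_m (X *m A *m X) m m) 0 q)) *m X) i j =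
    \sum_k \sum_l (\sum_m X i m * X j m * X k m * X l m) * A k l.
  transitivity (\sum_m \sum_k \sum_l X i m * X j m * X k m * X l m * A k l).
    rewrite mxE; apply: eq_bigr => m _; rewrite !mxE.
    have -> : \sum_j0 (X *m A) m j0 * X j0 m = (X *m A *m X) m m by rewrite [RHS]mxE.
    rewrite mulmx3E mulr_sumr mulr_suml; apply: eq_bigr => k _.
    rewrite mulr_sumr mulr_suml; apply: eq_bigr => l _.
    by rewrite (Xsym m k) (Xsym m j); ring.
  rewrite exchange_big; apply: eq_bigr => k _; rewrite exchange_big.
  by apply: eq_bigr => l _; rewrite mulr_suml.
rewrite E1 E2 E3 E4 -!big_split /= !(mulr_suml, mulr_sumr) -!sumrB -!big_split /=.
rewrite mulr_sumr; apply: eq_bigr => k _.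
rewrite -!big_split /= !(mulr_suml, mulr_sumr) -!sumrB -!big_split /= mulr_sumr.
apply: eq_bigr => l _; rewrite ent4_mx4 /pert_ker4; ring.
Qed.

Hypotheses (c0 : 0 < c) (a1 : a != 1).

Let cn0 : c != 0. Proof. by rewrite gt_eqF. Qed.
Let na1 : 1 - a != 0. Proof. by rewrite subr_eq0 eq_sym. Qed.

Lemma pert_map_flat (A : 'M[R]_N) : flat_pert X c (pert_map X c a A).
Proof.
split.
- rewrite /pert_map; set B := _ - _; have BT : B^T = B.
    rewrite /B linearB /= linearZ /= linearD /= trmxK (addrC A^T).
    by rewrite linearZ /= tr_diag_mx.
  by rewrite linearZ /= linearD /= linearZ /= !trmx_mul BT XT mulmxA.
- rewrite /pert_map; set B := _ - _; move: (_ * \tr _) => s.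
  rewrite -scalemxAl [RHS]scalerA mulrC -scalerA; congr (_ *: _).
  by rewrite mulmxDl -mulmxA XX -!scalemxAl XX -scalemxAr scalerDr !scalerA (mulrC s).
move=> i; set d := \row_m (X *m A *m X) m m.
have dE m : d 0 m = (X *m A *m X) m m by rewrite mxE.
have tr_d : \sum_m d 0 m = c * \tr (X *m A).
  under eq_bigr do rewrite dE.
  by rewrite -/(mxtrace _) mxtrace_mulC mulmxA XX -scalemxAl mxtraceZ.
have Ai : (X *m A^T *m X) i i = d 0 i.
  have -> : X *m A^T *m X = (X *m A *m X)^T by rewrite !trmx_mul XT mulmxA.
  by rewrite dE mxE.
(* Equiangularity enters here: the entrywise square of [X] is $(1-a)I + aJ$, and it is applied to
   [d]. *)
have diag_i : (X *m diag_mx d *m X) i i = a * (c * \tr (X *m A)) + (1 - a) * d 0 i.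
  transitivity (\sum_j X i j ^+ 2 * d 0 j).
    rewrite mul_mx_diag mxE; apply: eq_bigr => j _.
    by rewrite [X in X * _]mxE (Xsym j i) mulrAC -expr2.
  rewrite -tr_d mulr_sumr (bigD1 i) //= [in RHS](bigD1 i) //= X1 expr1n.
  rewrite (eq_bigr (fun j => a * d 0 j)) => [|j ji]; first by ring.
  by rewrite Xa // eq_sym.
rewrite scalemxE addmxE mulmxBr mulmxBl -!scalemxAr -!scalemxAl mulmxDr mulmxDl.
rewrite addmxE -scaleN1r !scalemxE addmxE Ai diag_i -dE X1.
by field; rewrite na1.
Qed.

(** Here $XAX = c^2 A$ has zero diagonal, so both correction terms vanish. *)
Lemma pert_map_fix (A : 'M[R]_N) : flat_pert X c A -> pert_map X c a A = A.
Proof.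
move=> [AT AX A0].
have XA : X *m A = c *: A by apply: trmx_inj; rewrite trmx_mul AT XT AX linearZ /= AT.
have XAX : X *m A *m X = c ^+ 2 *: A by rewrite XA -scalemxAl AX scalerA expr2.
have d0 : \row_m (X *m A *m X) m m = 0.
  by apply/rowP => m; rewrite mxE XAX scalemxE A0 mulr0 mxE.
have tr0 : \tr (X *m A) = 0.
  by rewrite XA mxtraceZ /mxtrace big1 ?mulr0.
rewrite /pert_map d0 tr0 mulr0 scale0r addr0 linear0 scaler0 subr0 AT.
rewrite -mulr2n -scaler_nat scalerA mulVf ?pnatr_eq0 // scale1r XAX scalerA.
by rewrite mulVf ?scale1r // expf_neq0.
Qed.

(** Symmetry is read off the kernel. Idempotence and the range follow because [pert_map] takes
    values in the flat perturbations and fixes each of them. *)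
Lemma pert_ker4_proj : orth_proj (mx4 (pert_ker4 X c a)) (vec_pert X).
Proof.
split.
- apply: eq_ent4 => i j k l; rewrite /ent4 mxE -!/(ent4 _ _ _ _ _) !ent4_mx4.
  rewrite /pert_ker4; congr (_ * (_ - _ * (_ - _ * _))).
  + by rewrite (Xsym k i) (Xsym l j) (Xsym k j) (Xsym l i); ring.
  + by apply: eq_bigr => m _; ring.
  + exact: mulrC.
- apply: eq_mulmx_cV => w; rewrite -(vecK w) -mulmxA !mulmx_pert_ker4.
  by rewrite (pert_map_fix (pert_map_flat _)).
move=> v; split=> [[w ->]|[A [pA ->]]].
  exists (pert_map X c a (vec_mx w^T)); rewrite -mulmx_pert_ker4 vecK; split=> //.
  by apply: (flat_pert_pert c0) => //; exact: pert_map_flat.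
exists (vec A); rewrite mulmx_pert_ker4 pert_map_fix //.
exact: pert_flat.
Qed.

(** For $c = N/r$ this is $r(r+1)/2 - N$, the dimension of the space of perturbations. *)
Lemma tr_pert_ker4 : \tr (mx4 (pert_ker4 X c a)) =
  ((N%:R / c) ^+ 2 + N%:R / c) / 2 - N%:R.
Proof.
transitivity (\sum_i \sum_j pert_ker4 X c a i j i j).
  rewrite /mxtrace sum_mxvec_index; apply: eq_bigr => i _; apply: eq_bigr => j _.
  by rewrite -[LHS]/(ent4 _ i j i j) ent4_mx4.
have S2 : \sum_i \sum_j X i j ^+ 2 = N%:R * c.
  under eq_bigr do rewrite etf_gram_row_norm.
  by rewrite sumr_const card_ord mulr_natl.
have S1 : \sum_(i < N) \sum_(j < N) (1 : R) = N%:R ^+ 2.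
  by under eq_bigr do rewrite sumr_const card_ord;
  rewrite sumr_const card_ord expr2 mulr_natl.
(* For fixed [m] the double sum factors into two squared row norms. *)
have S4 : \sum_i \sum_j \sum_m X i m ^+ 2 * X j m ^+ 2 = N%:R * c ^+ 2.
  transitivity (\sum_m (\sum_i X m i ^+ 2) * (\sum_j X m j ^+ 2)).
    rewrite [RHS](eq_bigr (fun m => \sum_i \sum_j X i m ^+ 2 * X j m ^+ 2)).
      rewrite [RHS]exchange_big; apply: eq_bigr => i _; exact: exchange_big.
    move=> m _; rewrite mulr_suml; apply: eq_bigr => i _; rewrite mulr_sumr.
    by apply: eq_bigr => j _; rewrite (Xsym i) (Xsym j).
  under eq_bigr do rewrite etf_gram_row_norm.
  by rewrite sumr_const card_ord expr2 mulr_natl.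
transitivity (c ^- 2 * ((N%:R ^+ 2 + N%:R * c) / 2 -
    (1 - a)^-1 * (N%:R * c ^+ 2 - a * c * (N%:R * c)))); last first.
  by field; rewrite cn0 na1.
rewrite -S4 -S1 -{1 2}S2 -big_split /= mulr_suml !mulr_sumr -sumrB mulr_sumr.
rewrite -sumrB mulr_sumr; apply: eq_bigr => i _.
rewrite -big_split /= mulr_suml !mulr_sumr -sumrB mulr_sumr.
rewrite -sumrB mulr_sumr; apply: eq_bigr => j _.
rewrite /pert_ker4 !X1 mul1r (Xsym j i) -!expr2.
congr (_ * (_ - _ * (_ - _))).
by apply: eq_bigr => m _; ring.
Qed.

(** By symmetry of the projection this is a diagonal entry of one of its columns read as a matrix,
    and such a matrix is a flat perturbation. *)
Lemma pert_ker4_diag i j k : pert_ker4 X c a i j k k = 0.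
Proof.
have [PT _ _] := pert_ker4_proj; rewrite -ent4_mx4 -PT /ent4 mxE.
set P := mx4 _; set p := mxvec_index _ _; set q := mxvec_index _ _.
have -> : P p q = (P *m vec (vec_mx (delta_mx q 0)^T)) p 0 by rewrite vecK -colE [RHS]mxE.
by rewrite mulmx_pert_ker4 vecE; have [_ _ ->] := pert_map_flat (vec_mx (delta_mx q 0)^T).
Qed.

(** * Pseudomoment matrices from the projection, and the obstruction *)

(** The projection vanishes at the pairs [(k, k)], so those columns of [Y] reproduce [X]; this
    settles everything but semidefiniteness, which holds because $K P = K P^T P$ is added to an
    outer product. *)
Lemma pert_proj_pseudomoment4 (K : R) (Y : 'M[R]_(N * N)) :
  0 <= K -> Y = vec X *m (vec X)^T + K *: mx4 (pert_ker4 X c a) ->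
  (forall i j k l a b c d : 'I_N, perm_eq [:: i; j; k; l] [:: a; b; c; d] ->
     ent4 Y i j k l = ent4 Y a b c d) ->
  pseudomoment4 Y /\ extends4 Y X.
Proof.
move=> K0 YE Yperm; have [PT PP _] := pert_ker4_proj.
have Ykk i j k : ent4 Y i j k k = X i j.
  rewrite YE {1}/ent4 addmxE scalemxE -!/(ent4 _ _ _ _ _) ent4_outer ent4_mx4.
  by rewrite pert_ker4_diag X1 mulr0 addr0 mulr1.
split; last first.
  move=> o i j _; rewrite -(Ykk i j o); apply: Yperm.
  by rewrite (perm_catCA [:: o] [:: i] [:: o; j]) /= perm_cons (perm_catC [:: o; o] [:: j]).
split=> //; last by move=> i; rewrite Ykk.
- split; first by rewrite YE linearD /= trmx_mul trmxK linearZ /= PT.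
  move=> x; rewrite YE mulmxDr mulmxDl addmxE -scalemxAr -scalemxAl scalemxE.
  apply: addr_ge0; last apply: mulr_ge0 => //.
    rewrite mulmxA -mulmxA; have -> : x^T *m vec X = ((vec X)^T *m x)^T.
      by rewrite trmx_mul trmxK.
    exact: sqr_cV_ge0.
  rewrite -PP (mulmxA x^T) -(mulmxA _ _ x); set P := mx4 _ in PT *.
  have -> : x^T *m P = (P *m x)^T by rewrite trmx_mul PT.
  exact: sqr_cV_ge0.
- by move=> i j k k'; rewrite !Ykk.
Qed.

(* If [pert X] is trivial then every column of an extension [Y], viewed as a
   matrix, differs from a multiple of [X] by an element of [pert X], so
   [Y = vec X *m (vec X)^T], and symmetry in the indices forces [X i j ^+ 2 = 1]. *)
Lemma E4_tr_pert_ker4_gt0 :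
  (0 < N)%N -> c != N%:R -> E4 X -> 0 < \tr (mx4 (pert_ker4 X c a)).
Proof.
move=> N0 cN [_ [Y [[psdY Ykk _ Yperm] Yext]]]; rewrite ltNge; apply/negP => trP.
have [PT PP _] := pert_ker4_proj.
have P0 := sym_idem_tr_le0 PT PP trP.
have flat0 A : flat_pert X c A -> A = 0.
  move=> /pert_map_fix fA; apply: vec_inj; rewrite -{1}fA -mulmx_pert_ker4 P0 mul0mx.
  by rewrite /vec !linear0.
pose o := Ordinal N0.
have Ydiag i j k : ent4 Y i j k k = X i j.
  rewrite (Ykk i j k o) -(Yext o i j) //; apply: Yperm; rewrite perm_sym.
  by rewrite (perm_catCA [:: o] [:: i] [:: o; j]) /= perm_cons (perm_catC [:: o; o] [:: j]).
have Yii i j l : ent4 Y i j i l = X j l.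
  rewrite -(Ydiag j l i); apply: Yperm.
  by rewrite (perm_catCA [:: i] [:: j] [:: i; l]) /= perm_cons (perm_catC [:: i; i] [:: l]).
have Ysym i j k l : ent4 Y i j k l = ent4 Y k l i j.
  by apply: Yperm; rewrite (perm_catC [:: i; j] [:: k; l]).
(* For $Xu = 0$ take $z = e_i \otimes u$. The block of [Y] at [i] is [X], so $z^T Y z = u^T X u = 0$
   and semidefiniteness gives $Yz = 0$. *)
have Yker (u : 'cV[R]_N) i k l : X *m u = 0 -> \sum_q ent4 Y i q k l * u q 0 = 0.
  move=> Xu; pose z := vec (\matrix_(p, q) ((p == i)%:R * u q 0)).
  have Yz k' l' : (Y *m z) (mxvec_index k' l') 0 = \sum_q ent4 Y i q k' l' * u q 0.
    rewrite mulmx_vecE (bigD1 i) //= [X in _ + X]big1 => [|p /negPf pi]; last first.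
      by apply: big1 => q _; rewrite mxE pi mul0r mulr0.
    rewrite addr0; apply: eq_bigr => q _.
    by rewrite mxE eqxx mul1r Ysym.
  have zYz : (z^T *m Y *m z) 0 0 = 0.
    rewrite -mulmxA mxE sum_mxvec_index (bigD1 i) //= [X in _ + X]big1 => [|p /negPf pi].
      rewrite addr0; apply: big1 => l' _; rewrite Yz.
      have -> : \sum_q ent4 Y i q i l' * u q 0 = (X *m u) l' 0.
        by rewrite mxE; apply: eq_bigr => q _; rewrite Yii Xsym.
      by rewrite Xu [X in _ * X]mxE mulr0.
    by apply: big1 => q _; rewrite mxE vecE mxE pi !mul0r.
  by rewrite -Yz (psd_quad0 psdY zYz) mxE.
have Yout i j k l : ent4 Y i j k l = X k l * X i j.
  pose B := \matrix_(i, j) ent4 Y i j k l - X k l *: X.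
  suff /flat0/matrixP/(_ i j) : flat_pert X c B.
    by rewrite !mxE => /eqP; rewrite subr_eq0 => /eqP.
  split.
  - apply/matrixP => p q; rewrite !mxE (Xsym p q); congr (_ - _); apply: Yperm.
    by rewrite (perm_catCA [:: q] [:: p] [:: k; l]).
  - apply: mulmx_annihilator XX _ => u Xu.
    rewrite mulmxBl -scalemxAl Xu scaler0 subr0.
    apply/matrixP => p q; rewrite ord1 [RHS]mxE mxE -[RHS](Yker u p k l Xu).
    by apply: eq_bigr => s _; rewrite mxE.
  - by move=> p; rewrite !mxE X1 mulr1 Ysym Ydiag subrr.
(* The entry of [Y] at [(i, j), (i, j)] is both $X_{ij}^2$ and $X_{jj} = 1$; the row norm is then
   [N], against [cN]. *)
have X2 i j : X i j ^+ 2 = 1.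
  by rewrite expr2 -Yout -[1](X1 j) -(Yii i j j).
case/eqP: cN; rewrite -(etf_gram_row_norm o).
by under eq_bigr do rewrite X2; rewrite sumr_const card_ord.
Qed.

End ETFGram.

(** * Frames, the rank one case and the final assembly *)

Lemma ETF_gram (R : rcfType) N r (V : 'M[R]_(N, r)) :
  ETF V -> exists a, etf_gram (gram V) (N%:R / r%:R) a.
Proof.
move=> [[V1 VV] [alpha [_ Va]]]; exists (alpha ^+ 2); split.
- by rewrite /gram trmx_mul trmxK.
- by rewrite /gram mulmxA -(mulmxA V) VV mul_mx_scalar -scalemxAl.
- exact: V1.
by move=> i j ij; rewrite -(Va i j ij) real_normK ?num_real.
Qed.

Lemma UNTF_dim_gt0 (R : rcfType) N r (V : 'M[R]_(N, r)) :
  (0 < N)%N -> UNTF V -> (0 < r)%N.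
Proof.
move=> N0 [V1 _]; case: r V V1 => // V /(_ (Ordinal N0)) /eqP.
by rewrite mxE big_ord0 eq_sym oner_eq0.
Qed.

Lemma kronv_pseudomoment4 (R : rcfType) N (x : 'cV[R]_N) :
  (forall i, x i 0 ^+ 2 = 1) ->
  pseudomoment4 (kronv x *m (kronv x)^T) /\ extends4 (kronv x *m (kronv x)^T) (x *m x^T).
Proof.
move=> x1; set Y := kronv x *m _.
have YE i j k l : ent4 Y i j k l = x i 0 * x j 0 * (x k 0 * x l 0).
  by rewrite /Y -[kronv x]/(vec _) ent4_outer !mxE.
split; last first.
  by move=> o i j _; rewrite YE mxE big_ord1 mxE mulrACA -expr2 x1 mul1r.
split.
- split; first by rewrite trmx_mul trmxK.
  move=> y; rewrite mulmxA -mulmxA; set z := (kronv x)^T *m y.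
  have -> : y^T *m kronv x = z^T by rewrite trmx_mul trmxK.
  exact: sqr_cV_ge0.
- by move=> i j k k'; rewrite !YE -!expr2 !x1.
- by move=> i; rewrite YE -!expr2 x1 expr1n.
by apply: perm_eq_invariant4 => i j k l; rewrite !YE; ring.
Qed.

(** One of [r] and [r.+1] is even, so the integer quotient is exact. *)
Lemma ltn_half_pronic (R : rcfType) (N r : nat) :
  (N < r * r.+1 %/ 2)%N = (0 < (r * r.+1)%:R / 2 - N%:R :> R).
Proof.
have -> : (r * r.+1)%:R / 2 = (r * r.+1 %/ 2)%N%:R :> R.
  have ev : ~~ odd (r * r.+1) by rewrite oddM oddS andbN.
  have n2 : 2 != 0 :> R by rewrite pnatr_eq0.
  by apply: (mulIf n2); rewrite divfK // -natrM divnK // dvdn2.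
by rewrite subr_gt0 ltr_nat.
Qed.

(** Compares the two formulas for [Y] entrywise: [n] and [s] stand for [N] and [r], [p] for
    $X_{ij}X_{kl}$, [q] for the other two pairings and [S] for the quartic sum. The factor of the
    projection is the one that gives all three pairings the same coefficient. *)
Lemma etf_coefficients (R : rcfType) (n s a D p q S : R) :
  0 < n -> n != 1 -> 1 < s -> D != 0 -> D = s * (s + 1) / 2 - n ->
  n / s = 1 + (n - 1) * a ->
  s * (s - 1) / 2 / D * (p + q) - s ^+ 2 * (1 - n^-1) / D * S =
  p + n ^+ 2 * (1 - s^-1) / D * ((n / s) ^- 2 *
    (q / 2 - (1 - a)^-1 * (S - a * (n / s) * p))).
Proof.
move=> n0 n1 s1 D0 DE aE.
have nn : n != 0 by rewrite gt_eqF.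
have sn : s != 0 by rewrite gt_eqF //; lra.
have s1n : s - 1 != 0 by rewrite gt_eqF //; lra.
have n1n : n - 1 != 0 by rewrite subr_eq0.
have aV : a = (n - s) / (s * (n - 1)).
  by apply: (mulfI n1n); apply: (addrI 1); rewrite -aE; field; rewrite sn n1n.
have bE : (1 - a)^-1 = s * (n - 1) / (n * (s - 1)).
  rewrite -invf_div; congr (_^-1); rewrite aV; field.
  by rewrite sn n1n.
rewrite bE aV.
(* [D] is kept as an atom. The coefficient of [p] needs the form $1 + (n-s)/D$, while that of [q] is
   restored to its original form below. *)
have -> : s * (s - 1) / 2 / D = (D + n - s) / D by rewrite DE; congr (_ / _); field.
have h : s * (s - 1) / 2 = D + n - s by rewrite DE; field.
rewrite mulrDr.
have -> : (D + n - s) / D * q = s * (s - 1) / 2 / D * q by rewrite h.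
by field; rewrite nn sn s1n n1n D0.
Qed.

Theorem theorem4 (R : rcfType) (N r : nat) (V : 'M[R]_(N, r)) :
  (0 < N)%N -> ETF V ->
  let X := gram V in
  (E4 X <-> ((N < r * r.+1 %/ 2)%N \/ r = 1%N)) /\
  (r = 1%N ->
     exists x : 'cV[R]_N,
       (forall i, x i 0 = 1 \/ x i 0 = -1) /\ X = x *m x^T /\
       pseudomoment4 (kronv x *m (kronv x)^T) /\
       extends4 (kronv x *m (kronv x)^T) X) /\
  ((1 < r)%N -> (N < r * r.+1 %/ 2)%N ->
     let D : R := (r * r.+1)%:R / 2 - N%:R in
     let Y := mx4 (fun i j k l =>
        ((r * r.-1)%:R / 2) / D * (X i j * X k l + X i k * X j l + X i l * X j k)
        - (r%:R ^+ 2 * (1 - N%:R^-1)) / D *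
            \sum_(m < N) X i m * X j m * X k m * X l m) in
     pseudomoment4 Y /\ extends4 Y X /\
     forall P : 'M[R]_(N * N), orth_proj P (vec_pert X) ->
       Y = vec X *m (vec X)^T + ((N%:R ^+ 2 * (1 - r%:R^-1)) / D) *: P).
Proof.
move=> N0 etfV X; have [a etfX] := ETF_gram etfV.
have r0 : (0 < r)%N by case: etfV => /(UNTF_dim_gt0 N0).
have n0 : 0 < N%:R :> R by rewrite ltr0n.
have s0 : 0 < r%:R :> R by rewrite ltr0n.
have c0 : 0 < N%:R / r%:R :> R by rewrite divr_gt0.
have cE := etf_gram_constants etfX N0.
have XT : X^T = X by case: etfX.
have cN : (1 < r)%N -> N%:R / r%:R != N%:R :> R.
  move=> r1; rewrite lt_eqF // ltr_pdivrMr // ltr_pMr //.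
  by rewrite ltr1n.
have a1 : (1 < r)%N -> a != 1.
  by move=> /cN; apply: contraNneq => a1; rewrite cE a1 mulr1 addrC subrK.
(* The equivalence is proved last, since its converse uses both constructions. *)
have split3 (P Q S : Prop) : Q -> S -> (Q -> S -> P) -> P /\ Q /\ S.
  by move=> q s f; split; [exact: f|].
apply: split3.
- move=> r1; have [[V1 _] _] := etfV; move: V V1 @X {etfV etfX cE cN a1 c0 s0 r0 XT}.
  rewrite r1 => V V1 X; exists V.
  have V2 i : V i 0 ^+ 2 = 1.
    by have := V1 i; rewrite mxE big_ord1 mxE expr2.
  split=> [i|]; first by have /eqP := V2 i; rewrite sqrf_eq1 => /orP[]/eqP ->; [left|right].
  by split=> //; exact: kronv_pseudomoment4.
- move=> r1 Nr D Y; have D0 : 0 < D by rewrite /D -ltn_half_pronic.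
  have s1 : 1 < r%:R :> R by rewrite ltr1n.
  set K := _ * _ / D.
  have K0 : 0 <= K.
    apply: divr_ge0; last exact: ltW.
    by rewrite mulr_ge0 ?sqr_ge0 // subr_ge0 invf_le1 // ltW.
  (* A single vector would give $1/r = c = 1$, against $r > 1$; the coefficient identity divides by
     $N - 1$. *)
  have n1 : N%:R != 1 :> R.
    apply: contraTneq s1 => n1; move: cE; rewrite n1 subrr mul0r addr0 div1r.
    by move/(congr1 GRing.inv); rewrite invrK invr1 => ->; rewrite ltxx.
  have YE : Y = vec X *m (vec X)^T + K *: mx4 (pert_ker4 X (N%:R / r%:R) a).
    apply: eq_ent4 => i j k l; rewrite ent4_mx4 {1}/ent4 addmxE scalemxE.
    rewrite -!/(ent4 _ _ _ _ _) ent4_outer ent4_mx4 -addrA.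
    rewrite natrM -[r.-1]subn1 natrB //.
    apply: etf_coefficients => //; first exact: lt0r_neq0.
    by rewrite /D natrM natr1.
  have [|Y4 YX] := pert_proj_pseudomoment4 etfX c0 (a1 r1) K0 YE.
    have Xsym i j : X i j = X j i by rewrite -{1}XT mxE.
    apply: perm_eq_invariant4 => i j k l; rewrite !ent4_mx4.
    - congr (_ * _ - _ * _); last by apply: eq_bigr => m _; ring.
      by rewrite (Xsym j i); ring.
    - congr (_ * _ - _ * _); last by apply: eq_bigr => m _; ring.
      by rewrite (Xsym k j); ring.
    - congr (_ * _ - _ * _); last by apply: eq_bigr => m _; ring.
      by rewrite (Xsym l k); ring.
  split=> //; split=> // P projP; rewrite YE; congr (_ + _ *: _).
  exact: orth_proj_unique (pert_ker4_proj etfX c0 (a1 r1)) projP.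
- move=> rank1 formula; split=> [E4X|].
    have [r1|] := leqP r 1; first by right; apply/anti_leq; rewrite r1.
    move=> r1; left; rewrite (ltn_half_pronic R).
    have := E4_tr_pert_ker4_gt0 etfX c0 (a1 r1) N0 (cN r1) E4X.
    rewrite tr_pert_ker4 // ?a1 //.
    have -> : N%:R / (N%:R / r%:R) = r%:R :> R by field; rewrite !gt_eqF.
    by rewrite natrM -[r.+1%:R]natr1 mulrDr mulr1 expr2.
  have [r1|r1] := leqP r 1.
    have {}r1 : r = 1%N by apply/anti_leq; rewrite r1.
    move=> _; have [x [_ [_ [Y4 YX]]]] := rank1 r1.
    by split=> //; exists (kronv x *m (kronv x)^T).
  case=> [Nr|r1']; last by rewrite r1' in r1.
  have [Y4 [YX _]] := formula r1 Nr.
  by split=> //; eexists; split; [exact: Y4 | exact: YX].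
Qed.
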